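(* Let $v\geq 2$ and $0\leq \Delta<v$ be integers and let $L\geq 0$ be an integer. Then \[ \sum_{m,k,n_1,\ldots,n_{v-1}\geq 0} q^{(m+k)^2+k^2+\Delta(m+2k)+\sum_{j=1}^{v-1}N_j^2+\sum_{t=v-\Delta}^{v-1}N_t}\binom{L}{m,\,2k+\Delta}_q {k-\sum_{t=1}^{v-2}N_t \brack n_{v-1}}_{q^2}\prod_{j=1}^{v-2}{n_j+2k-2\sum_{t=1}^{j}N_t+\min(\Delta,v-1-j) \brack n_j}_q \] \[ =\sum_{j=-\infty}^{\infty}(-1)^j q^{(2v+1)vj^2+(2v+1)\Delta j}{2L \brack L-\Delta-2vj}_q . \]
   Context: For integers $n\ge 0$, $(a;q)_n=\prod_{j=0}^{n-1}(1-aq^j)$ and $(q)_n=(q;q)_n$. For integers $m,n$, the $q$-binomial coefficient is ${n+m \brack n}_q=\frac{(q)_{n+m}}{(q)_n(q)_m}$ if $m,n\geq 0$ and $0$ otherwise; ${\cdot \brack \cdot}_{q^2}$ denotes the same with $q$ replaced by $q^2$. The $q$-trinomial is $\binom{L}{m,n}_q={L \brack m}_q{L-m \brack n}_q$. For summation variables $n_1,\ldots,n_{v-1}$, $N_j=\sum_{t=j}^{v-1}n_t$. Empty sums are $0$ and empty products are $1$. *)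

(* Defs.v *)
From mathcomp Require Import all_boot all_order all_algebra zify.
From mathcomp Require Import boolp classical_sets functions cardinality fsbigop.

Set Implicit Arguments.
Unset Strict Implicit.
Unset Printing Implicit Defensive.
Import Order.TTheory GRing.Theory Num.Theory.
Local Open Scope classical_set_scope.
Local Open Scope ring_scope.

Section QSeries.
Variable F : fieldType.
Implicit Type q : F.

Definition qpoch (a q : F) (n : nat) : F := \prod_(j < n) (1 - a * q ^+ j).

(* [a over b]_q; writing a = n + m and b = n, the condition 0 <= b <= a is
   m, n >= 0. *)
Definition qbin q (a b : int) : F :=
  if (0 <= b) && (b <= a) then
    qpoch q q `|a|%N / (qpoch q q `|b|%N * qpoch q q `|a - b|%N)
  else 0.

Definition qtrin q (L m n : int) : F := qbin q L m * qbin q (L - m) n.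

(* A tuple [tnth n 0; ...; tnth n (v-2)] stands for (n_1, ..., n_(v-1)):
   the summation variables are numbered from 1. *)
Definition nvar (v : nat) (n : v.-1.-tuple nat) (j : nat) : nat :=
  nth 0%N n j.-1.

Definition Nsum (v : nat) (n : v.-1.-tuple nat) (j : nat) : nat :=
  (\sum_(j <= t < v) nvar n t)%N.

Definition lhs_exponent (v Delta m k : nat) (n : v.-1.-tuple nat) : nat :=
  ((m + k) ^ 2 + k ^ 2 + Delta * (m + 2 * k)
   + \sum_(1 <= j < v) Nsum n j ^ 2 + \sum_(v - Delta <= t < v) Nsum n t)%N.

Definition lhs_term q (v Delta L : nat) (x : nat * nat * v.-1.-tuple nat) : F :=
  let: (m, k, n) := x in
  q ^+ lhs_exponent Delta m k n
  * qtrin q L%:Z m%:Z (2 * k + Delta)%N%:Z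
  * qbin (q ^+ 2) (k%:Z - (\sum_(1 <= t < v.-1) Nsum n t)%N%:Z)
      (nvar n v.-1)%:Z
  * \prod_(1 <= j < v.-1)
      qbin q ((nvar n j)%:Z + 2 * k%:Z
              - 2 * (\sum_(1 <= t < j.+1) Nsum n t)%N%:Z
              + (minn Delta (v - 1 - j))%:Z)
        (nvar n j)%:Z.

Definition rhs_term q (v Delta L : nat) (j : int) : F :=
  (-1) ^ j
  * q ^ ((2 * v%:Z + 1) * v%:Z * j ^+ 2 + (2 * v%:Z + 1) * Delta%:Z * j)
  * qbin q (2 * L%:Z) (L%:Z - Delta%:Z - 2 * v%:Z * j).

Lemma qbin_neq0 q (a b : int) : qbin q a b != 0 -> 0 <= b <= a.
Proof. by rewrite /qbin; case: ifP => //; rewrite eqxx. Qed.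

Lemma nvar_le_Nsum1 (v : nat) (n : v.-1.-tuple nat) (i : nat) :
  i \in (n : seq nat) -> (i <= Nsum n 1)%N.
Proof.
move=> ni; rewrite /Nsum.
have lti : (index i n < v.-1)%N by rewrite -{2}(size_tuple n) index_mem.
rewrite (big_cat_nat (n := (index i n).+1)) //=; last by lia.
rewrite [X in (_ + X)%N]big_ltn; last by lia.
by rewrite /nvar /= nth_index //; lia.
Qed.

(* \sum_(x \in A) is 0 by convention when the support is infinite; this lemma
   and the next show that the convention plays no role for the two sums. *)
Lemma finite_lhs_support q (v Delta L : nat) : (2 <= v)%N ->
  finite_set [set x | lhs_term q (v := v) Delta L x != 0].
Proof.
move=> v2; pose B := (L + L + v).+1.
pose T := ('I_B * 'I_B * v.-1.-tuple 'I_B)%type.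
pose f (x : T) : nat * nat * v.-1.-tuple nat :=
  (val x.1.1, val x.1.2, map_tuple val x.2).
apply: (@sub_finite_set _ _ (f @` [set: T])); last first.
  exact/finite_image/finite_finset.
move=> [[m k] n] /=; rewrite /qtrin !mulf_eq0 !negb_or -!andbA.
move=> /and5P[_ /qbin_neq0 h1 /qbin_neq0 h2 /qbin_neq0 h3 hp].
have N1 : (Nsum n 1 <= k + v)%N.
  case: (ltnP 2 v) => v3; last first.
    have {v3}Ev : v = 2%N by lia.
    by subst v; rewrite /Nsum big_nat1; move: h3; rewrite big_geq //=; lia.
  move: hp; rewrite big_ltn; last by lia.
  rewrite mulf_eq0 negb_or => /andP[/qbin_neq0 + _].
  by rewrite big_nat1; lia.
exists (inord m, inord k, map_tuple inord n) => //.
rewrite /f /= !inordK; [|by rewrite /B; lia..].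
congr (_, _, _); apply: val_inj => /=.
rewrite -map_comp -[RHS]map_id; apply/eq_in_map => i /nvar_le_Nsum1 hi /=.
by rewrite inordK // /B; lia.
Qed.

Lemma finite_rhs_support q (v Delta L : nat) : (2 <= v)%N ->
  finite_set [set j | rhs_term q v Delta L j != 0].
Proof.
move=> v2; pose B := (L + Delta).+1.
pose f (i : 'I_(B + B)) : int := (val i)%:Z - B%:Z.
apply: (@sub_finite_set _ _ (f @` [set: 'I_(B + B)])); last first.
  exact/finite_image/finite_finset.
move=> j /=; rewrite /rhs_term !mulf_eq0 !negb_or => /andP[_ /qbin_neq0 h].
have hj : `|j| <= L%:Z + Delta%:Z by nia.
have lt : (`|(j + B%:Z)%R| < B + B)%N by rewrite /B; lia.
by exists (Ordinal lt) => //; rewrite /f /= /B; lia.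
Qed.

End QSeries.

(* Main.v *)
Require Import Defs.
From mathcomp Require Import all_boot all_order all_algebra zify ring.
From mathcomp Require Import classical_sets fsbigop.

Set Implicit Arguments.
Unset Strict Implicit.
Unset Printing Implicit Defensive.
Import Order.TTheory GRing.Theory Num.Theory.
Local Open Scope classical_set_scope.
Local Open Scope ring_scope.

(** For fixed k, the sum over n_1, ..., n_(v-1) equals
      \sum_j (-1)^j q^(v j^2 + Delta j) [2k + Delta, k - v j]_q .
    Peeling off N_(v-1), N_(v-2), ... one at a time is an iterated Burge
    transform: each step sends a product of two q-binomial coefficients to
    another such product by the q-Pfaff-Saalschuetz sum, and the iteration
    starts from
      [n, l]_(q^2) = \sum_j (-1)^j q^(j^2) [n, l + j]_q [n, l - j]_q .
    Once the inner sum has this form, the sum over m and k is evaluated term by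
    term with two q-Vandermonde summations.  Negative powers of q occur on the
    way, so q = 0 is treated apart; a single term then survives on each side. *)

Section FiniteSupport.
Variable V : nmodType.

Lemma fsum_finType (T : finType) (I : choiceType) (h : T -> I) (f : I -> V) :
  injective h -> (forall i, f i != 0 -> exists t, h t = i) ->
  \sum_(i \in [set: I]) f i = \sum_t f (h t).
Proof.
move=> h_inj supp_f; rewrite (fsbigE (map h (index_enum T))) //.
- by rewrite big_map; apply: eq_bigl => t; rewrite in_setT.
- by rewrite map_inj_uniq // index_enum_uniq.
- move=> i _; apply: contraNeq => /supp_f[t <-].
  by rewrite map_f // mem_index_enum.
Qed.

Lemma fsum_supp1 (I : choiceType) (i0 : I) (f : I -> V) :
  (forall i, f i != 0 -> i = i0) -> \sum_(i \in [set: I]) f i = f i0.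
Proof.
move=> supp_f; rewrite (@fsum_finType unit _ (fun=> i0)) => [|[] []//|i].
  by rewrite (big_pred1 tt) // => -[].
by move=> /supp_f->; exists tt.
Qed.

Lemma fsum_int_window (f : int -> V) (a : int) (n : nat) :
  (forall j, f j != 0 -> a <= j < a + n%:Z) ->
  \sum_(j \in [set: int]) f j = \sum_(t < n) f (a + t%:Z).
Proof.
move=> supp_f; apply: (fsum_finType (h := fun t : 'I_n => a + t%:Z)).
  by move=> s t /addrI[] /val_inj.
move=> j /supp_f /andP[le_aj lt_jan].
have lt_n : (`|j - a| < n)%N by lia.
by exists (Ordinal lt_n) => /=; lia.
Qed.

Lemma sum_int_window (f : int -> V) (a b : int) (m n : nat) :
  (forall j, f j != 0 -> (a <= j < a + m%:Z) && (b <= j < b + n%:Z)) ->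
  \sum_(t < m) f (a + t%:Z) = \sum_(t < n) f (b + t%:Z).
Proof.
by move=> supp_f; rewrite -!fsum_int_window // => j /supp_f/andP[].
Qed.

End FiniteSupport.

(* The sum of f over [-B, B[, folded by the involution j |-> -1 - j, so that
   antisymmetric sums vanish term by term, also in characteristic 2. *)
Definition sumZ (V : nmodType) (B : nat) (f : int -> V) : V :=
  \sum_(t < B) (f (Posz t) + f (Negz t)).

Section SumZ.
Variables (V : zmodType) (B : nat).
Implicit Type f : int -> V.

Lemma eq_sumZ f g : f =1 g -> sumZ B f = sumZ B g.
Proof. by move=> fg; apply: eq_bigr => t _; rewrite !fg. Qed.

Lemma sumZD f g : sumZ B (fun j => f j + g j) = sumZ B f + sumZ B g.
Proof. by rewrite /sumZ -big_split; apply: eq_bigr => t _; rewrite addrACA. Qed.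

Lemma exchange_sumZ (I : finType) (P : pred I) (f : I -> int -> V) :
  \sum_(i | P i) sumZ B (f i) = sumZ B (fun j => \sum_(i | P i) f i j).
Proof.
by rewrite exchange_big /=; apply: eq_bigr => t _; rewrite big_split.
Qed.

Lemma sumZ_antisym f : (forall j, f (-1 - j) = - f j) -> sumZ B f = 0.
Proof.
move=> f_anti; apply: big1 => t _.
have -> : Negz t = -1 - Posz t by lia.
by rewrite f_anti subrr.
Qed.

Lemma sumZ_fsum f : (forall j, f j != 0 -> - B%:Z <= j < B%:Z) ->
  sumZ B f = \sum_(j \in [set: int]) f j.
Proof.
move=> supp_f; pose h (t : 'I_B + 'I_B) : int :=
  match t with inl t => Posz t | inr t => Negz t end.
rewrite (@fsum_finType _ _ _ h) => [|[s|s] [t|t] //= [] /val_inj->//|].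
  by rewrite big_sumType /= -big_split.
move=> [] t /supp_f ht.
  have lt_tB : (t < B)%N by lia.
  by exists (inl (Ordinal lt_tB)).
have lt_tB : (t < B)%N by lia.
by exists (inr (Ordinal lt_tB)).
Qed.

End SumZ.

Lemma mulr_sumZ (R : pzRingType) (B : nat) (c : R) (f : int -> R) :
  c * sumZ B f = sumZ B (fun j => c * f j).
Proof. by rewrite /sumZ mulr_sumr; apply: eq_bigr => t _; rewrite mulrDr. Qed.

Section QBinomial.
Variables (F : fieldType) (q : F).

Lemma qbin_outside (a b : int) : ~~ (0 <= b <= a) -> qbin q a b = 0.
Proof. by rewrite /qbin => /negPf->. Qed.

Lemma qbin_sym (a b : int) : qbin q a b = qbin q a (a - b).
Proof.
rewrite /qbin; have -> : (0 <= b) && (b <= a) = (0 <= a - b) && (a - b <= a).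
  by lia.
by rewrite subKr [X in _ / X]mulrC.
Qed.

Hypothesis q_generic : forall i : nat, (0 < i)%N -> q ^+ i != 1.

Lemma qpoch_neq0 n : qpoch q q n != 0.
Proof.
apply/prodf_neq0 => i _; rewrite -exprS subr_eq0 eq_sym.
exact: q_generic.
Qed.

Lemma qbin_qpoch (m n : nat) :
  qbin q (m + n)%N m = qpoch q q (m + n) / (qpoch q q m * qpoch q q n).
Proof.
rewrite /qbin; have -> : (0 <= m%:Z) && (m%:Z <= (m + n)%N%:Z) by lia.
by congr (_ / (_ * qpoch _ _ _)); lia.
Qed.

Lemma qbin0 (n : nat) : qbin q n 0 = 1.
Proof.
by rewrite -[n]add0n qbin_qpoch /qpoch big_ord0 mul1r divff ?qpoch_neq0.
Qed.

Lemma qbinn (n : nat) : qbin q n n = 1.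
Proof. by rewrite qbin_sym subrr qbin0. Qed.

Lemma qbin0n (b : int) : qbin q 0 b = (b == 0)%:R.
Proof.
have [->|b_neq0] := eqVneq b 0; first exact: (qbin0 0).
by rewrite qbin_outside //; lia.
Qed.

(* The excluded case is [0, 0] = 1, whose right-hand side vanishes. *)
Lemma qbin_pascal (a b : int) : (a != -1) || (b != 0) ->
  qbin q (a + 1) b = qbin q a b + q ^ (a + 1 - b) * qbin q a (b - 1).
Proof.
move=> ab; have [|out] := boolP ((0 <= b) && (b <= a + 1)); last first.
  by rewrite !qbin_outside ?mulr0 ?addr0 //; lia.
case: b ab => [[|m]|//] ab /= le_ma.
  have [n ->] : exists n : nat, a = n by exists `|a|%N; lia.
  by rewrite -PoszD addn1 !qbin0 qbin_outside ?mulr0 ?addr0.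
have -> : m.+1%:Z - 1 = m by lia.
have [->|ne_ma] := eqVneq a m.
  rewrite -PoszD addn1 !qbinn subrr mul1r qbin_outside ?add0r //; lia.
have [n ->] : exists n, a = (m.+1 + n)%N by exists `|(a - m.+1%:Z)%R|%N; lia.
have -> : (m.+1 + n)%N%:Z + 1 = (m.+1 + n.+1)%N by lia.
have -> : (m.+1 + n.+1)%N%:Z - m.+1%:Z = n.+1 by lia.
rewrite !qbin_qpoch [(m.+1 + n)%N]addSnnS qbin_qpoch addSn -exprnP.
have qpochS i : qpoch q q i.+1 = qpoch q q i * (1 - q ^+ i.+1).
  by rewrite /qpoch big_ord_recr /= exprS.
have q_expD : q ^+ (m + n.+1).+1 = q ^+ m.+1 * q ^+ n.+1 by rewrite -exprD.
have [nz_m nz_n] : 1 - q ^+ m.+1 != 0 /\ 1 - q ^+ n.+1 != 0.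
  by rewrite !subr_eq0 ![1 == _]eq_sym !q_generic.
rewrite !qpochS q_expD.
move: (q ^+ m.+1) (q ^+ n.+1) nz_m nz_n => x y nz_x nz_y.
by field; rewrite !qpoch_neq0 nz_x nz_y.
Qed.

Lemma qbin_pascal_dual (a b : int) : (a != -1) || (b != 0) ->
  qbin q (a + 1) b = q ^ b * qbin q a b + qbin q a (b - 1).
Proof.
move=> ab; rewrite qbin_sym qbin_pascal; last by lia.
rewrite addrC [in RHS]qbin_sym [X in _ = _ + X]qbin_sym.
by congr (q ^ _ * qbin _ _ _ + qbin _ _ _); lia.
Qed.

Lemma qtrinE (a b c : int) :
  qtrin q a b c = qbin q a (b + c) * qbin q (b + c) b.
Proof.
rewrite /qtrin; have [/and3P[]|out] := boolP [&& 0 <= b, 0 <= c & b + c <= a].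
  case: b c => // x [] // y _ _ le_xya.
  have [z ->] : exists z, a = (x + (y + z))%N.
    by exists `|(a - x%:Z - y%:Z)%R|%N; lia.
  rewrite qbin_qpoch (_ : (x + (y + z))%N%:Z - x%:Z = (y + z)%N); last by lia.
  by rewrite addnA -PoszD !qbin_qpoch; field; rewrite !qpoch_neq0.
transitivity (0 : F); last apply/esym; apply/eqP/negPn/negP;
  by rewrite mulf_eq0 negb_or => /andP[/qbin_neq0 ? /qbin_neq0 ?]; lia.
Qed.

Lemma qtrinC (a b c : int) : qtrin q a b c = qtrin q a c b.
Proof.
rewrite !qtrinE [c + b]addrC [qbin q (b + c) b]qbin_sym.
by congr (_ * qbin q _ _); ring.
Qed.

Lemma qtrin_mul_qbin (a b c d : int) :
  qtrin q a b (c + d) * qbin q (c + d) c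
  = qtrin q a b c * qbin q (a - (b + c)) d.
Proof. by rewrite {1}/qtrin -mulrA -qtrinE /qtrin mulrA opprD addrA. Qed.

Lemma coef_qbinomial_prod (z : F) (n a : nat) :
  (\prod_(i < n) (1 + (z * q ^+ i) *: 'X))`_a
  = z ^+ a * q ^+ 'C(a, 2) * qbin q n a.
Proof.
elim: n a => [|n IHn] a.
  by rewrite big_ord0 coef1 qbin0n //; case: a => [|a]; rewrite ?mulr0 ?mulr1.
rewrite big_ord_recr /= mulrDr mulr1 -scalerAr coefD coefZ coefMX IHn.
case: a => [|a]; first by rewrite !qbin0 mulr0 addr0.
rewrite IHn -[n.+1]addn1 PoszD qbin_pascal //=.
rewrite (_ : a.+1%:Z - 1 = a); last by lia.
have [->|/qbin_neq0 le_an] := eqVneq (qbin q n a) 0.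
  by rewrite !mulr0 !addr0.
rewrite (_ : n%:Z + 1 - a.+1%:Z = (n - a)%N); last by lia.
have -> : q ^+ n = q ^+ a * q ^+ (n - a) by rewrite -exprD subnKC //; lia.
by rewrite binS bin1 exprD !exprS -exprnP; ring.
Qed.

End QBinomial.

Lemma double_bin2 (n : nat) : 2 * 'C(n, 2)%:Z = n%:Z * (n%:Z - 1).
Proof.
have := bin_ffact n 2; rewrite ffactnS ffactn1 (_ : 2`! = 2)%N //.
by case: n => [|n] /=; lia.
Qed.

Section BurgeTransform.
Variables (F : fieldType) (q : F).
Hypothesis q_generic : forall i : nat, (0 < i)%N -> q ^+ i != 1.
Hypothesis q_neq0 : q != 0.

Lemma qbin_vandermonde (m n b : int) (N : nat) : 0 <= m < N%:Z -> 0 <= n ->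
  \sum_(r < N) q ^ (r%:Z * (r%:Z + b)) * qbin q m r * qbin q n (r%:Z + b)
  = qbin q (m + n) (m + b).
Proof.
case: m n => [] // m [] // n lt_mN _; have {lt_mN} : (m < N)%N := lt_mN.
elim: m n N b => [|m IHm] n [|N] b // lt_mN.
  rewrite big_ord_recl big1 => [|r _]; last by rewrite qbin0n // mulr0 mul0r.
  by rewrite mul0r expr0z (qbin0 q_generic) !mul1r addr0 !add0r.
rewrite (_ : m.+1%:Z + n = m%:Z + n.+1); last by lia.
rewrite (_ : m.+1%:Z + b = m%:Z + (b + 1)); last by lia.
rewrite -(IHm _ _ _ lt_mN).
pose f (r : int) := q ^ (r * (r + b) + r) * qbin q m r * qbin q n (r + b).
pose g (r : int) := q ^ (r * (r + b)) * qbin q m (r - 1) * qbin q n (r + b).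
transitivity (\sum_(r < N.+1) (f r + g r)).
  apply: eq_bigr => r _; rewrite -[m.+1]addn1 PoszD.
  by rewrite (qbin_pascal_dual q_generic) // mulrDr mulrDl mulrA -expfzDr.
rewrite big_split /= big_ord_recr [X in _ + X]big_ord_recl /=.
have -> : f N = 0 by rewrite /f qbin_outside ?mulr0 ?mul0r //; lia.
have -> : g 0 = 0 by rewrite /g [qbin q m _]qbin_outside ?mulr0 ?mul0r //; lia.
rewrite addr0 add0r -big_split; apply: eq_bigr => r _ /=.
have -> : (bump 0 r)%:Z = r%:Z + 1 by rewrite /bump; lia.
rewrite -[n.+1]addn1 PoszD addrA.
rewrite (qbin_pascal_dual q_generic) ?addrK; last by lia.
rewrite /f /g !addrK [RHS]mulrDr addrC; congr (_ + _ * _ * _).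
  rewrite mulrA [X in _ = X * _]mulrAC -expfzDr // addrAC.
  by congr (q ^ _ * _ * _); ring.
by congr (q ^ _); ring.
Qed.

(* Expanding [m + n + M - r, M - r] by Vandermonde makes the sum over r, and
   then the sum over the expansion index, a Vandermonde sum again. *)
Lemma qbin_saalschutz (m n b M : int) (N : nat) : 0 <= m < N%:Z -> 0 <= n ->
  \sum_(r < N) q ^ (r%:Z * (r%:Z + b)) * qbin q (m + n + M - r%:Z) (M - r%:Z)
     * qbin q m r * qbin q n (r%:Z + b)
  = qbin q (n + M) (M + b) * qbin q (m + M + b) M.
Proof.
move=> /andP[m_ge0 lt_mN] n_ge0; have [M_lt0|M_ge0] := ltP M 0.
  rewrite [X in _ = _ * X]qbin_outside ?mulr0 ?big1 // => [r _|]; last by lia.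
  by rewrite [qbin q _ (M - _)]qbin_outside ?(mulr0, mul0r) //; lia.
pose c (k : int) := q ^ (k * (k + (M - m))) * qbin q (n + M) (k + (M - m)).
pose t (r : int) := q ^ (r * (r + b)) * qbin q n (r + b).
transitivity (\sum_(r < N) \sum_(k < N) c k * t r * qtrin q m r k).
  apply: eq_bigr => r _; rewrite /qtrin /t.
  have [->|/qbin_neq0 le_rm] := eqVneq (qbin q m r) 0.
    by rewrite mulr0 mul0r big1 // => k _; rewrite mul0r mulr0.
  rewrite (_ : m + n + M - r%:Z = m - r%:Z + (n + M)); last by ring.
  rewrite (_ : M - r%:Z = m - r%:Z + (M - m)); last by ring.
  rewrite -(@qbin_vandermonde _ _ _ N); [|lia..].
  by rewrite mulr_sumr !mulr_suml; apply: eq_bigr => k _; rewrite /c; ring.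
rewrite exchange_big /=; transitivity (\sum_(k < N) qbin q (n + M) (M + b)
    * (q ^ (k%:Z * (k%:Z + (M - m))) * qbin q m k
       * qbin q (M + b) (k%:Z + (M - m)))).
  apply: eq_bigr => k _.
  transitivity (c k * (qbin q m k * \sum_(r < N) q ^ (r%:Z * (r%:Z + b))
      * qbin q (m - k%:Z) r * qbin q n (r%:Z + b))).
    rewrite !mulr_sumr; apply: eq_bigr => r _.
    by rewrite (qtrinC q_generic) /qtrin /t; ring.
  have [->|/qbin_neq0 le_km] := eqVneq (qbin q m k) 0.
    by rewrite !(mul0r, mulr0).
  rewrite qbin_vandermonde; [|lia..].
  have := qtrinE q_generic (n + M) (k%:Z + (M - m)) (m - k%:Z + b).
  rewrite /qtrin (_ : _ + (_ + b) = M + b); last by ring.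
  rewrite (_ : n + M - _ = m - k%:Z + n); last by ring.
  by rewrite /c => tE; ring: tE.
rewrite -mulr_sumr; have [Mb_lt0|Mb_ge0] := ltP (M + b) 0.
  by rewrite qbin_outside ?mul0r //; lia.
rewrite qbin_vandermonde //; last by lia.
by congr (_ * qbin q _ _); ring.
Qed.

Definition burge_kernel (m n a b r : int) : F :=
  q ^ ((r + a) * (r + b)) * qbin q m (r + a) * qbin q n (r + b).

Lemma burge_kernel_neq0 (m n a b r : int) :
  burge_kernel m n a b r != 0 -> (0 <= r + a <= m) && (0 <= r + b <= n).
Proof.
by rewrite !mulf_eq0 !negb_or -andbA => /and3P[_ /qbin_neq0-> /qbin_neq0->].
Qed.

Lemma sum_burge_kernel_shift (m n a b : int) (M N : nat) (g : int -> F) :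
  (a <= 0) || (b <= 0) -> 0 <= m < N%:Z ->
  (forall r, g r * burge_kernel m n a b r != 0 -> r < M%:Z) ->
  \sum_(r < M) g r * burge_kernel m n a b r =
  \sum_(r < N) g (r%:Z - a) * burge_kernel m n 0 (b - a) r.
Proof.
move=> ab m_lt supp_g; pose f r := g r * burge_kernel m n a b r.
transitivity (\sum_(r < M) f (0 + r%:Z)).
  by apply: eq_bigr => r _; rewrite add0r.
rewrite (@sum_int_window _ f _ (- a) _ N); last first.
  move=> r nz; have lt_rM := supp_g r nz.
  by move: nz; rewrite mulf_eq0 negb_or => /andP[_ /burge_kernel_neq0]; lia.
apply: eq_bigr => r _.
by rewrite /f /burge_kernel addrC addrNK addr0 addrA addrAC.
Qed.

Section BurgeSums.
Variables (m n a b : int).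
Hypothesis ab_le0 : (a <= 0) || (b <= 0).
Hypothesis mn_lt0 : (m < 0) || (n < 0) -> (m + b < a) || (n + a < b).

Lemma sum_burge_kernel (M : nat) : (m - a < M%:Z) || (n - b < M%:Z) ->
  \sum_(r < M) burge_kernel m n a b r = qbin q (m + n) (m + b - a).
Proof.
move=> lt_M; have [mn_neg|mn_nneg] := boolP ((m < 0) || (n < 0)).
  rewrite qbin_outside ?big1 // => [r _|]; last by move: (mn_lt0 mn_neg); lia.
  by apply/eqP/negPn/negP => /burge_kernel_neq0; lia.
have m_bounds : 0 <= m < `|m|.+1%N%:Z by lia.
under eq_bigr do rewrite -[burge_kernel _ _ _ _ _]mul1r.
rewrite (sum_burge_kernel_shift (g := fun=> 1) ab_le0 m_bounds); last first.
  by move=> r; rewrite mul1r => /burge_kernel_neq0; lia.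
rewrite -addrA -(@qbin_vandermonde _ _ _ `|m|.+1); [|lia..].
by apply: eq_bigr => r _; rewrite mul1r /burge_kernel addr0.
Qed.

Lemma sum_qbin_burge_kernel (M : nat) :
  \sum_(r < M.+1)
    qbin q (m + n + M%:Z - r%:Z) (M%:Z - r%:Z) * burge_kernel m n a b r
  = qbin q (n + M%:Z + a) (M%:Z + b) * qbin q (m + M%:Z + b) (M%:Z + a).
Proof.
have [mn_neg|mn_nneg] := boolP ((m < 0) || (n < 0)).
  rewrite big1 => [|r _]; last first.
    have [->|/burge_kernel_neq0] := eqVneq (burge_kernel m n a b r) 0.
      exact: mulr0.
    by lia.
  by case/orP: (mn_lt0 mn_neg) => lt_ab; [rewrite mulrC|];
    rewrite qbin_outside ?mul0r //; lia.
have m_bounds : 0 <= m < `|m|.+1%N%:Z by lia.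
pose g (r : int) := qbin q (m + n + M%:Z - r) (M%:Z - r).
rewrite (sum_burge_kernel_shift (g := g) ab_le0 m_bounds); last first.
  by move=> r; rewrite mulf_eq0 negb_or => /andP[/qbin_neq0 + _]; lia.
transitivity (qbin q (n + (M%:Z + a)) (M%:Z + a + (b - a))
    * qbin q (m + (M%:Z + a) + (b - a)) (M%:Z + a)).
  rewrite -(@qbin_saalschutz _ _ _ _ `|m|.+1); [|lia..].
  apply: eq_bigr => r _; rewrite /g /burge_kernel addr0.
  rewrite (_ : m + n + M%:Z - _ = m + n + (M%:Z + a) - r%:Z); last by ring.
  by rewrite (_ : M%:Z - _ = M%:Z + a - r%:Z); ring.
by congr (qbin q _ _ * qbin q _ _); ring.
Qed.

End BurgeSums.

Lemma qtrin_vandermonde (L : nat) (d : int) (B : nat) : (L < B)%N ->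
  \sum_(i < B) \sum_(a < B) q ^ (i%:Z * (i%:Z + d) + a%:Z * (a%:Z + d))
     * qtrin q L a (i%:Z - a%:Z) * qbin q (L%:Z - i%:Z) (a%:Z + d)
  = qbin q (2 * L%:Z) (L%:Z + d).
Proof.
move=> lt_LB; rewrite (_ : 2 * L%:Z = L%:Z + L); last by ring.
rewrite -(@qbin_vandermonde _ _ _ B); [|lia..].
apply: eq_bigr => i _; have [Li0|/qbin_neq0 le_iL] := eqVneq (qbin q L i) 0.
  rewrite Li0 mulr0 mul0r big1 // => a _.
  by rewrite (qtrinE q_generic) subrKC Li0 mul0r mulr0 mul0r.
have -> : qbin q L (i%:Z + d) = qbin q (i%:Z + (L%:Z - i%:Z)) (i%:Z + d).
  by rewrite subrKC.
rewrite -(@qbin_vandermonde _ _ _ B); [|lia..].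
rewrite mulr_sumr; apply: eq_bigr => a _.
by rewrite (qtrinE q_generic) subrKC expfzDr //; ring.
Qed.

Lemma sum_qtrin (Delta L B : nat) (s : int) :
  (L < B)%N -> (0 <= s) || (s <= - Delta%:Z) ->
  \sum_(m < B) \sum_(k < B)
     q ^+ ((m + k) ^ 2 + k ^ 2 + Delta * (m + 2 * k))
     * qtrin q L m (2 * k + Delta)%N * qbin q (2 * k%:Z + Delta%:Z) (k%:Z - s)
  = q ^ (2 * s ^+ 2 + 2 * Delta%:Z * s)
     * qbin q (2 * L%:Z) (L%:Z - Delta%:Z - 2 * s).
Proof.
move=> lt_LB s_range; pose d : int := 2 * s + Delta%:Z.
pose f (i a : int) := q ^ (i * (i + d) + a * (a + d))
  * qtrin q L a (i - a) * qbin q (L%:Z - i) (a + d).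
have supp_f i a : f i a != 0 ->
    [&& 0 <= i <= L%:Z, 0 <= a <= i & 0 <= a + d <= L%:Z - i].
  rewrite /f (qtrinE q_generic) subrKC !mulf_eq0 !negb_or -!andbA.
  by move=> /and4P[_ /qbin_neq0 + /qbin_neq0 + /qbin_neq0]; lia.
have termE (m k : nat) : q ^+ ((m + k) ^ 2 + k ^ 2 + Delta * (m + 2 * k))
     * qtrin q L m (2 * k + Delta)%N * qbin q (2 * k%:Z + Delta%:Z) (k%:Z - s)
    = q ^ (2 * s ^+ 2 + 2 * Delta%:Z * s)
      * f (m%:Z + (- s + k%:Z)) (- s + k%:Z).
  rewrite /f addrK [in RHS](qtrinC q_generic) [- s + _]addrC.
  set a : int := k%:Z - s.
  have c1E : (2 * k + Delta)%N = a + (a + d) :> int by rewrite /a /d; lia.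
  have c2E : 2 * k%:Z + Delta%:Z = a + (a + d) by rewrite /a /d; ring.
  rewrite c1E c2E -mulrA qtrin_mul_qbin //.
  move: (qtrin _ _ _ _) => t; rewrite !mulrA -expfzDr // [q ^+ _]exprnP.
  by congr (q ^ _ * _ * _); rewrite /a /d; lia.
transitivity (q ^ (2 * s ^+ 2 + 2 * Delta%:Z * s)
    * \sum_(m < B) \sum_(a < B) f (m%:Z + (0 + a%:Z)) (0 + a%:Z)).
  rewrite mulr_sumr; apply: eq_bigr => m _; under eq_bigr do rewrite termE.
  rewrite -mulr_sumr; congr (_ * _).
  apply: (sum_int_window (f := fun a => f (m%:Z + a) a)) => a /supp_f.
  by rewrite /d; lia.
rewrite exchange_big (_ : L%:Z - _ - _ = L%:Z - d); last by rewrite /d; ring.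
rewrite [qbin q (2 * _) _]qbin_sym (_ : _ - (_ - d) = L%:Z + d); last by ring.
rewrite -(@qtrin_vandermonde _ _ B) // [in RHS]exchange_big.
congr (_ * _); apply: eq_bigr => a _; rewrite add0r.
under eq_bigr do rewrite addrC.
under [RHS]eq_bigr do rewrite -[Posz _]add0r.
by apply: (sum_int_window (f := fun i => f i a)) => i /supp_f; lia.
Qed.

(* Compare coefficients in (x; q)_n (-x; q)_n = (x^2; q^2)_n. *)
Lemma qbin_q2_convolution (n l : nat) :
  \sum_(a < (2 * l).+1) (-1) ^+ a * q ^+ ('C(a, 2) + 'C(2 * l - a, 2))
     * qbin q n a * qbin q n (2 * l - a)%N
  = (-1) ^+ l * q ^+ (2 * 'C(l, 2)) * qbin (q ^+ 2) n l.
Proof.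
have q2_generic (i : nat) : (0 < i)%N -> (q ^+ 2) ^+ i != 1.
  by move=> i_gt0; rewrite -exprM q_generic // muln_gt0.
pose p (z : F) := \prod_(i < n) (1 + (z * q ^+ i) *: 'X).
transitivity ((p (-1) * p 1)`_(2 * l)).
  rewrite coefM; apply: eq_bigr => a _.
  by rewrite !(coef_qbinomial_prod q_generic) expr1n exprD; ring.
have -> : p (-1) * p 1
    = (\prod_(i < n) (1 + (-1 * (q ^+ 2) ^+ i) *: 'X)) \Po 'X^2.
  rewrite rmorph_prod -big_split; apply: eq_bigr => i _ /=.
  rewrite rmorphD rmorph1 /= comp_polyZ comp_polyX -exprM mulnC exprM.
  by rewrite -!mul_polyC !(polyCM, polyCN, polyC_exp); ring.
rewrite coef_comp_poly_Xn // dvdn_mulr // mulKn //.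
by rewrite (coef_qbinomial_prod q2_generic) -exprM.
Qed.

Lemma qbin_q2_sumZ (B : nat) (n l : int) : n < B%:Z ->
  qbin (q ^+ 2) n l =
  sumZ B (fun j => (-1) ^ j * q ^ (j ^+ 2)
                   * qbin q n (l + j) * qbin q n (l - j)).
Proof.
move=> lt_nB; pose f j :=
  (-1) ^ j * q ^ (j ^+ 2) * qbin q n (l + j) * qbin q n (l - j).
have supp_f j : f j != 0 -> (0 <= l + j <= n) && (0 <= l - j <= n).
  rewrite !mulf_eq0 !negb_or -!andbA => /and4P[_ _ /qbin_neq0 + /qbin_neq0].
  by lia.
rewrite sumZ_fsum => [|j /supp_f]; last by lia.
have [/andP[n_ge0 l_ge0]|nl_lt0] := boolP ((0 <= n) && (0 <= l)); last first.
  rewrite qbin_outside ?fsbig1 // => [j _|]; last by lia.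
  by apply/eqP/negPn/negP => /supp_f; lia.
case: n l n_ge0 l_ge0 @f supp_f {lt_nB} => // n [] // l _ _ f supp_f.
rewrite (fsum_int_window (a := - l%:Z) (n := (2 * l).+1)) => [|j /supp_f];
  last by lia.
have c_neq0 : (-1) ^+ l * q ^+ (2 * 'C(l, 2)) != 0.
  by rewrite mulf_neq0 ?expf_neq0 // oppr_eq0 oner_eq0.
apply: (mulfI c_neq0); rewrite -qbin_q2_convolution mulr_sumr.
apply: eq_bigr => a _.
have le_a2l : (a <= 2 * l)%N by rewrite -ltnS.
have signE : (-1) ^+ a = (-1) ^+ l * (-1) ^ (- l%:Z + a) :> F.
  by rewrite !exprnP -expfzDr ?oppr_eq0 ?oner_eq0 // addNKr.
have powE : q ^+ ('C(a, 2) + 'C(2 * l - a, 2))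
    = q ^+ (2 * 'C(l, 2)) * q ^ ((- l%:Z + a) ^+ 2).
  rewrite ![q ^+ _]exprnP -expfzDr //; congr (q ^ _).
  have := double_bin2 l; have := double_bin2 a.
  have := double_bin2 (2 * l - a)%N.
  by rewrite (_ : (2 * l - a)%N%:Z = 2 * l%:Z - a%:Z) ?expr2; lia.
rewrite /f signE powE addNKr (_ : l%:Z - _ = (2 * l - a)%N); last by lia.
by ring.
Qed.

(* The j-th term of the alternating sum reached after i Burge steps.  D stands
   for min(Delta, i); e is 0, or 1 to prepare a step that raises D. *)
Definition bose (D e i L M j : int) : F :=
  (-1) ^ j * q ^ ((i + 1) * j ^+ 2 + D * j)
  * qbin q (L + M + D + i * j) (L + D + (i + 1) * j)
  * qbin q (L + M + e - i * j) (L - (i + 1) * j).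

(* Pascal's rule on the last factor; the extra term is antisymmetric under
   j |-> -1 - j. *)
Lemma sumZ_bose1 (B : nat) (i L M : int) : 0 <= i ->
  sumZ B (bose i 1 i L M) = sumZ B (bose i 0 i L M).
Proof.
move=> i_ge0; pose h (j : int) := (-1) ^ j * q ^ ((i + 1) * (j ^+ 2 + j))
  * qbin q (L + M + i + i * j) (L + i + (i + 1) * j)
  * qbin q (L + M - i * j) (L - (i + 1) * j - 1).
have sum_h : sumZ B h = 0.
  apply: sumZ_antisym => j; rewrite /h.
  rewrite (_ : (-1 - j) ^+ 2 + (-1 - j) = j ^+ 2 + j); last by ring.
  rewrite (_ : L + M + i + i * (-1 - j) = L + M - i * j); last by ring.
  rewrite (_ : L + M - i * (-1 - j) = L + M + i + i * j); last by ring.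
  rewrite (_ : L + i + (i + 1) * (-1 - j) = L - (i + 1) * j - 1); last by ring.
  rewrite (_ : L - (i + 1) * (-1 - j) - 1 = L + i + (i + 1) * j); last by ring.
  rewrite expfzDr ?oppr_eq0 ?oner_neq0 // exprN1 invrN1 -exprz_inv invrN1.
  by ring.
have -> : sumZ B (bose i 0 i L M)
    = sumZ B (fun j => bose i 0 i L M j + q ^ (M + 1) * h j).
  by rewrite sumZD -mulr_sumZ sum_h mulr0 addr0.
apply: eq_sumZ => j; rewrite /bose /h.
have [->|/qbin_neq0 supp_j] :=
    eqVneq (qbin q (L + M + i + i * j) (L + i + (i + 1) * j)) 0.
  by rewrite !(mulr0, mul0r) addr0.
rewrite [L + M + 1 - _]addrAC (qbin_pascal q_generic); last by nia.
have -> : q ^ (L + M - i * j + 1 - (L - (i + 1) * j)) = q ^ (M + 1) * q ^ j.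
  by rewrite -expfzDr //; congr (q ^ _); ring.
have -> : q ^ ((i + 1) * (j ^+ 2 + j)) = q ^ ((i + 1) * j ^+ 2 + i * j) * q ^ j.
  by rewrite -expfzDr //; congr (q ^ _); ring.
by rewrite addr0; ring.
Qed.

Lemma sumZ_bose (B : nat) (D i L M : int) (e : bool) : 0 <= i -> (e -> D = i) ->
  sumZ B (bose D e i L M) = sumZ B (bose D 0 i L M).
Proof. by case: e => // i_ge0 ->; rewrite ?sumZ_bose1. Qed.

Lemma bose_burge_kernel (D e i L r j : int) :
  q ^ (r ^+ 2 + e * r) * bose D e i (L - r) r j =
  (-1) ^ j * q ^ ((i + 2) * j ^+ 2 + (D + e) * j)
  * burge_kernel (L + e - i * j) (L + D + i * j) (e + j) (- j) r.
Proof.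
have powE : q ^ (r ^+ 2 + e * r) * q ^ ((i + 1) * j ^+ 2 + D * j) =
    q ^ ((i + 2) * j ^+ 2 + (D + e) * j) * q ^ ((r + (e + j)) * (r - j)).
  by rewrite -!expfzDr //; congr (q ^ _); ring.
rewrite /burge_kernel /bose subrK.
rewrite [qbin q _ (r + (e + j))]qbin_sym [qbin q _ (r - j)]qbin_sym.
rewrite (_ : _ - (r + (e + j)) = L - r - (i + 1) * j); last by ring.
rewrite (_ : _ - (r - j) = L - r + D + (i + 1) * j); last by ring.
by ring: powE.
Qed.

Section BurgeStep.
Variables (D i L : int) (e : bool).
Hypothesis D_bounds : 0 <= D <= i + 1.
Hypothesis i_ge0 : 0 <= i.

Let shifts_le0 (j : int) : (e%:Z + j <= 0) || (- j <= 0).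
Proof. by case: e; lia. Qed.

Let shifts_nonoverlap (l j : int) :
  (l + e - i * j < 0) || (l + D + i * j < 0) ->
  (l + e - i * j - j < e%:Z + j) || (l + D + i * j + (e%:Z + j) < - j).
Proof.
have [j_ge0|j_lt0] := lerP 0 j.
  by have := mulr_ge0 i_ge0 j_ge0; lia.
have : i * j <= - i by nia.
by case: (e); lia.
Qed.

Lemma bose_burge (M : nat) (j : int) :
  \sum_(r < M.+1) q ^ (r%:Z ^+ 2 + e%:Z * r%:Z)
    * qbin q (M%:Z - r%:Z + 2 * L + D + e) (M%:Z - r%:Z)
    * bose D e i (L - r%:Z) r j
  = bose (D + e) e (i + 1) L M j.
Proof.
rewrite (_ : bose (D + e) e (i + 1) L M j =
    (-1) ^ j * q ^ ((i + 2) * j ^+ 2 + (D + e) * j)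
    * (qbin q (L + D + i * j + M%:Z + (e%:Z + j)) (M%:Z - j)
       * qbin q (L + e - i * j + M%:Z - j) (M%:Z + (e%:Z + j)))); last first.
  rewrite /bose [qbin q _ (M%:Z - j)]qbin_sym [qbin q _ (M%:Z + _)]qbin_sym.
  rewrite [RHS]mulrA.
  by congr (_ * q ^ _ * qbin q _ _ * qbin q _ _); ring.
rewrite -sum_qbin_burge_kernel ?shifts_le0 ?mulr_sumr //; last first.
  exact: shifts_nonoverlap.
apply: eq_bigr => r _; rewrite mulrAC bose_burge_kernel.
rewrite (_ : L + e - _ + _ + _ - _ = M%:Z - r%:Z + 2 * L + D + e); last by ring.
by ring.
Qed.

Lemma bose_vandermonde (k : nat) (j : int) :
  \sum_(r < k.+1) q ^ (r%:Z ^+ 2 + e%:Z * r%:Z) * bose D e i (k%:Z - r%:Z) r j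
  = (-1) ^ j * q ^ ((i + 2) * j ^+ 2 + (D + e) * j)
    * qbin q (2 * k%:Z + D + e) (k%:Z - (i + 2) * j).
Proof.
under eq_bigr do rewrite bose_burge_kernel.
rewrite -mulr_sumr sum_burge_kernel ?shifts_le0 //.
- by congr (_ * qbin q _ _); ring.
- exact: shifts_nonoverlap.
- by have [/(mulr_ge0 i_ge0)|j_lt0] := lerP 0 j; nia.
Qed.

End BurgeStep.
End BurgeTransform.

Local Notation ord_vals := (map (@nat_of_ord _)).

Section TupleSums.
Variables (R : Type) (idx : R) (op : Monoid.com_law idx) (T : finType).
Implicit Types (P : pred (seq T)) (G : seq T -> R).

Lemma big_tuple_cons (w : nat) P G :
  \big[op/idx]_(s : w.+1.-tuple T | P s) G s =
  \big[op/idx]_x \big[op/idx]_(s : w.-tuple T | P (x :: s)) G (x :: s).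
Proof.
rewrite pair_big_dep.
rewrite (reindex (fun p : T * w.-tuple T => [tuple of p.1 :: p.2])) //=.
exists (fun s => (thead s, [tuple of behead s])) => [[x s] _|s _] /=.
  by congr (_, _); apply: val_inj.
by rewrite [RHS]tuple_eta; apply: val_inj.
Qed.

End TupleSums.

Definition tailsum (s : seq nat) (j : nat) : nat := sumn (drop j s).

Lemma mem_leq_sumn (s : seq nat) (x : nat) : x \in s -> (x <= sumn s)%N.
Proof. by move=> /perm_to_rem/perm_sumn->; apply: leq_addr. Qed.

Lemma tailsum_nth (s : seq nat) (j : nat) :
  tailsum s j = (\sum_(j <= t < size s) nth 0 s t)%N.
Proof.
rewrite /tailsum sumnE (big_nth 0%N) size_drop -[in RHS](add0n j) big_addn.
by apply: eq_bigr => t _; rewrite nth_drop addnC.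
Qed.

Lemma Nsum_tailsum (v : nat) (n : v.-1.-tuple nat) (j : nat) :
  Nsum n j.+1 = tailsum n j.
Proof. by rewrite /Nsum big_add1 tailsum_nth size_tuple. Qed.

Section Weight.
Variables (F : fieldType) (q : F) (Delta : nat).

(* The part of the summand that involves s = [:: n_1; ...; n_(v-1)], with K in
   place of k; here tailsum s j is N_(j+1). *)
Definition weight (s : seq nat) (K : int) : F :=
  q ^+ (\sum_(0 <= j < size s) tailsum s j ^ 2
        + \sum_(size s - Delta <= j < size s) tailsum s j)
  * qbin (q ^+ 2) (K - (\sum_(0 <= j < (size s).-1) tailsum s j)%N%:Z)
      (last 0%N s)
  * \prod_(0 <= j < (size s).-1)
      qbin q ((nth 0%N s j)%:Z + 2 * K
              - 2 * (\sum_(0 <= t < j.+1) tailsum s t)%N%:Z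
              + (minn Delta ((size s).-1 - j))%:Z)
        (nth 0%N s j).

Lemma lhs_termE (v L m k : nat) (n : v.-1.-tuple nat) : (Delta < v)%N ->
  lhs_term q Delta L (m, k, n) =
    q ^+ ((m + k) ^ 2 + k ^ 2 + Delta * (m + 2 * k))
    * qtrin q L m (2 * k + Delta)%N * weight n k.
Proof.
move=> lt_Dv; rewrite /lhs_term /lhs_exponent /weight size_tuple.
rewrite -nth_last size_tuple.
rewrite (_ : v - Delta = (v.-1 - Delta).+1)%N; last by lia.
move: (qtrin _ _ _ _) => t.
rewrite -addnA exprD !big_add1 !mulrA [X in _ = X * _ * _]mulrAC.
congr (_ * q ^+ (_ + _) * _ * qbin _ (_ - Posz _) _ * _);
  apply: eq_bigr => j _; rewrite ?Nsum_tailsum //.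
rewrite /nvar big_add1 (_ : v - 1 - j.+1 = v.-2 - j)%N; last by lia.
by under eq_bigr do rewrite Nsum_tailsum.
Qed.

Lemma sum_tailsum_cons (n : nat) (s : seq nat) (w : nat) :
  (\sum_(0 <= t < w.+1) tailsum (n :: s) t
   = sumn (n :: s) + \sum_(0 <= t < w) tailsum s t)%N.
Proof. by rewrite big_nat_recl. Qed.

Lemma sum_last_tailsum_cons (n : nat) (s : seq nat) :
  (\sum_((size s).+1 - Delta <= j < (size s).+1) tailsum (n :: s) j
   = (size s < Delta) * sumn (n :: s)
     + \sum_(size s - Delta <= j < size s) tailsum s j)%N.
Proof.
have [lt_sD|le_Ds] := ltnP (size s) Delta; last by rewrite subSn // big_add1.
have [-> ->] : ((size s).+1 - Delta = 0 /\ size s - Delta = 0)%N by lia.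
by rewrite sum_tailsum_cons mul1n.
Qed.

Lemma weight1 (n : nat) (K : int) :
  weight [:: n] K = q ^+ (n ^ 2 + (0 < Delta) * n) * qbin (q ^+ 2) K n.
Proof.
rewrite /weight (sum_last_tailsum_cons n [::]) !big_nat1 !big_geq //.
by rewrite subr0 mulr1 addn0 /tailsum /= addn0.
Qed.

Lemma weight_cons (n : nat) (s : seq nat) (K : int) (N := sumn (n :: s)) :
  s != [::] ->
  weight (n :: s) K =
    q ^+ (N ^ 2 + (size s < Delta) * N)
    * qbin q (n%:Z + 2 * (K - N%:Z) + (minn Delta (size s))%:Z) n
    * weight s (K - N%:Z).
Proof.
rewrite -size_eq0 => s_neq0; have [w Es] : exists w, size s = w.+1.
  by exists (size s).-1; rewrite prednK // lt0n.
have last_s : last n s = last 0%N s by case: (s) Es.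
rewrite /weight [size (n :: s)]/= sum_last_tailsum_cons Es [last 0%N _]/=.
rewrite last_s [(\sum_(0 <= _ < w.+2) _)%N]big_nat_recl //.
rewrite [\prod_(0 <= _ < w.+1) _]big_nat_recl // !sum_tailsum_cons -/N subn0.
rewrite [(\sum_(0 <= _ < 0) _)%N]big_geq // addn0.
have -> : K - (N + \sum_(0 <= t < w) tailsum s t)%N%:Z
    = K - N%:Z - (\sum_(0 <= t < w) tailsum s t)%N%:Z by lia.
have -> : n%:Z + 2 * K - 2 * N%:Z = n%:Z + 2 * (K - N%:Z) by ring.
rewrite addnACA exprD.
set P := \prod_(_ <= _ < _) _; set P' := \prod_(_ <= _ < _) _.
suff -> : P = P' by rewrite /tailsum drop0 /=; ring.
apply: eq_bigr => j _; rewrite sum_tailsum_cons -/N.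
by congr (qbin q (_ + _) _); rewrite /=; lia.
Qed.

Lemma weight_neq0 (s : seq nat) (K : int) : s != [::] ->
  weight s K != 0 -> (sumn s)%:Z <= K.
Proof.
elim: s K => [//|n s IHs] K _; have [->|s_neq0] := eqVneq s [::].
  by rewrite weight1 mulf_eq0 negb_or => /andP[_ /qbin_neq0]; rewrite /=; lia.
rewrite weight_cons // mulf_eq0 negb_or => /andP[_ /(IHs _ s_neq0)] /=; lia.
Qed.

Definition weight_fiber (B w : nat) (K : int) (M : nat) : F :=
  \sum_(s : w.+1.-tuple 'I_B | sumn (ord_vals s) == M) weight (ord_vals s) K.

Lemma weight_fiber0 (B : nat) (K : int) (M : nat) : (M < B)%N ->
  weight_fiber B 0 K M = q ^+ (M ^ 2 + (0 < Delta) * M) * qbin (q ^+ 2) K M.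
Proof.
move=> lt_MB.
rewrite /weight_fiber (big_pred1 [tuple Ordinal lt_MB]) ?weight1 //.
case/tupleP=> x s; rewrite [s]tuple0 /= addn0 -val_eqE /= eqseq_cons andbT.
by rewrite -val_eqE.
Qed.

Lemma weight_fiberS (B w : nat) (K : int) (M : nat) : (M < B)%N ->
  weight_fiber B w.+1 K M = q ^+ (M ^ 2 + (w.+1 < Delta) * M)
    * \sum_(r < M.+1)
        qbin q (M%:Z - r%:Z + 2 * (K - M%:Z) + (minn Delta w.+1)%:Z)
          (M%:Z - r%:Z)
        * weight_fiber B w (K - M%:Z) r.
Proof.
move=> lt_MB; rewrite /weight_fiber.
rewrite (@big_tuple_cons _ _ _ _ w.+1 (fun s => sumn (ord_vals s) == M)
  (fun s => weight (ord_vals s) K)).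
under [in RHS]eq_bigr do rewrite mulr_sumr.
rewrite (exchange_big_dep xpredT) // [in RHS](exchange_big_dep xpredT) //=.
rewrite mulr_sumr; apply: eq_bigr => s _.
have [le_sM|lt_Ms] := leqP (sumn (ord_vals s)) M; last first.
  rewrite !big_pred0 ?mulr0 // => [r|x].
    by apply/negbTE; have := ltn_ord r; lia.
  by apply/negbTE; lia.
have lt_xB : (M - sumn (ord_vals s) < B)%N by lia.
have lt_sM : (sumn (ord_vals s) < M.+1)%N by lia.
rewrite (big_pred1 (Ordinal lt_xB)) => [|x]; last first.
  by rewrite /= -val_eqE /=; lia.
rewrite (big_pred1 (Ordinal lt_sM)) => [|r]; last first.
  by rewrite /= eq_sym -val_eqE.
rewrite weight_cons -?size_eq0 ?size_map ?size_tuple //= subnK // -subzn //.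
exact/esym/mulrA.
Qed.

Hypothesis q_generic : forall i : nat, (0 < i)%N -> q ^+ i != 1.
Hypothesis q_neq0 : q != 0.

Lemma weight_fiber_bose (B w : nat) (K : int) (M : nat) :
  (M < B)%N -> K < B%:Z ->
  weight_fiber B w K M = q ^+ (M ^ 2 + (w < Delta) * M)
    * sumZ B (bose q (minn Delta w) 0 w (K - M%:Z) M).
Proof.
elim: w K M => [|w IHw] K M lt_MB lt_KB.
  rewrite weight_fiber0 // minn0 qbin_sym.
  rewrite (@qbin_q2_sumZ _ _ q_generic q_neq0 B) //.
  congr (_ * _); apply: eq_sumZ => j; rewrite /bose.
  by congr (_ * q ^ _ * qbin q _ _ * qbin q _ _); ring.
rewrite weight_fiberS //; congr (_ * _).
set e := (w < Delta)%N; set D : int := minn Delta w.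
have De : D + e = minn Delta w.+1 by rewrite /D /e; lia.
rewrite -De -(@sumZ_bose _ _ q_generic q_neq0 _ _ _ _ _ e);
  [|rewrite /D /e; lia..].
rewrite -[w.+1]addn1 PoszD.
transitivity (sumZ B (fun j => \sum_(r < M.+1) q ^ (r%:Z ^+ 2 + e%:Z * r%:Z)
    * qbin q (M%:Z - r%:Z + 2 * (K - M%:Z) + D + e) (M%:Z - r%:Z)
    * bose q D e w (K - M%:Z - r%:Z) r j)); last first.
  by apply: eq_sumZ => j; rewrite bose_burge // /D; lia.
rewrite -exchange_sumZ; apply: eq_bigr => r _; have := ltn_ord r => lt_rM.
rewrite IHw; [|lia..].
rewrite -mulr_sumZ sumZ_bose //; last by rewrite /D /e; lia.
rewrite (_ : r%:Z ^+ 2 + _ = (r ^ 2 + e * r)%N); last by ring.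
by rewrite -exprnP addrA mulrCA mulrA.
Qed.

Lemma sum_weight (B w k : nat) : (k < B)%N ->
  \sum_(s : w.+1.-tuple 'I_B) weight (ord_vals s) k
  = \sum_(M < k.+1) weight_fiber B w k M.
Proof.
move=> lt_kB; rewrite (exchange_big_dep xpredT) //=; apply: eq_bigr => s _.
have [->|/weight_neq0 le_sk] := eqVneq (weight (ord_vals s) k) 0.
  by rewrite big1.
have lt_sk : (sumn (ord_vals s) < k.+1)%N.
  by rewrite ltnS -lez_nat le_sk // -size_eq0 size_map size_tuple.
by rewrite (big_pred1 (Ordinal lt_sk)) // => M; rewrite eq_sym -val_eqE.
Qed.

Lemma sum_weight_bose (B w k : nat) : (k < B)%N -> (Delta <= w.+1)%N ->
  \sum_(s : w.+1.-tuple 'I_B) weight (ord_vals s) k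
  = sumZ B (fun j => (-1) ^ j * q ^ ((w%:Z + 2) * j ^+ 2 + Delta%:Z * j)
      * qbin q (2 * k%:Z + Delta%:Z) (k%:Z - (w%:Z + 2) * j)).
Proof.
move=> lt_kB le_Dw; rewrite sum_weight //.
set e := (w < Delta)%N; set D : int := minn Delta w.
have De : Delta = D + e :> int by rewrite /D /e; lia.
transitivity (sumZ B (fun j => \sum_(r < k.+1) q ^ (r%:Z ^+ 2 + e%:Z * r%:Z)
    * bose q D e w (k%:Z - r%:Z) r j)); last first.
  apply: eq_sumZ => j.
  by rewrite bose_vandermonde // ?De ?addrA //; rewrite /D; lia.
rewrite -exchange_sumZ; apply: eq_bigr => r _; have := ltn_ord r => lt_rk.
rewrite weight_fiber_bose; [|lia..].
rewrite (_ : r%:Z ^+ 2 + _ = (r ^ 2 + e * r)%N); last by ring.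
by rewrite -exprnP -mulr_sumZ sumZ_bose //; rewrite /D /e; lia.
Qed.

End Weight.

Section Supports.
Variables (F : fieldType) (q : F) (v Delta L : nat).

Lemma lhs_term_supp (m k : nat) (n : v.-1.-tuple nat) :
  (2 <= v)%N -> (Delta < v)%N -> lhs_term q Delta L (m, k, n) != 0 ->
  [/\ (m <= L)%N, (k <= L)%N & (sumn n <= k)%N].
Proof.
move=> v_ge2 lt_Dv.
rewrite lhs_termE // mulf_eq0 negb_or => /andP[+ /weight_neq0].
rewrite -size_eq0 size_tuple !mulf_eq0 !negb_or.
by move=> /and3P[_ /qbin_neq0 m_le /qbin_neq0 k_le] sum_le; split; lia.
Qed.

Lemma rhs_term_supp (j : int) : (Delta < v)%N ->
  rhs_term q v Delta L j != 0 -> - L%:Z <= j <= L%:Z.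
Proof.
move=> lt_Dv; rewrite /rhs_term mulf_eq0 negb_or => /andP[_ /qbin_neq0].
nia.
Qed.

Lemma fsum_lhs_term : (2 <= v)%N -> (Delta < v)%N ->
  \sum_(x \in [set: nat * nat * v.-1.-tuple nat]) lhs_term q Delta L x =
  \sum_(m < L.+1) \sum_(k < L.+1)
    q ^+ ((m + k) ^ 2 + k ^ 2 + Delta * (m + 2 * k))
    * qtrin q L m (2 * k + Delta)%N
    * \sum_(s : v.-1.-tuple 'I_L.+1) weight q Delta (ord_vals s) k.
Proof.
move=> v_ge2 lt_Dv; pose h (x : 'I_L.+1 * 'I_L.+1 * v.-1.-tuple 'I_L.+1) :=
  (x.1.1 : nat, x.1.2 : nat, map_tuple (@nat_of_ord L.+1) x.2).
rewrite (@fsum_finType _ _ _ h); first last.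
- move=> [[m k] n] /(lhs_term_supp v_ge2 lt_Dv)[le_mL le_kL le_nk].
  exists (inord m, inord k, map_tuple inord n); rewrite /h /= !inordK //.
  congr (_, _, _); apply: val_inj => /=; rewrite -map_comp -[RHS]map_id.
  apply/eq_in_map => x /mem_leq_sumn le_xn /=.
  by rewrite inordK // ltnS (leq_trans le_xn) // (leq_trans le_nk).
- move=> [[m k] n] [[m' k'] n'] [/val_inj-> /val_inj-> /(inj_map val_inj) eq_n].
  by congr (_, _, _); apply: val_inj.
under [RHS]eq_bigr do under eq_bigr do rewrite mulr_sumr.
by rewrite !pair_big; apply: eq_bigr => -[[m k] s] _; apply: lhs_termE.
Qed.

End Supports.

Section QZero.
Variables (F : fieldType) (v Delta L : nat).
Hypothesis v_ge2 : (2 <= v)%N.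
Hypothesis lt_Dv : (Delta < v)%N.

Lemma qbin_q0 (a b : int) : qbin (0 : F) a b = (0 <= b <= a)%R%:R.
Proof.
have qpoch_q0 n : qpoch (0 : F) 0 n = 1.
  by rewrite /qpoch big1 // => i _; rewrite mul0r subr0.
by rewrite /qbin !qpoch_q0 mulr1 divr1; case: ifP.
Qed.

Lemma weight_q0 (w : nat) : weight (0 : F) Delta (nseq w 0%N) 0 = 1.
Proof.
have tailsum0 j : tailsum (nseq w 0%N) j = 0%N.
  by rewrite tailsum_nth big1 // => t _; rewrite nth_nseq if_same.
have sum0 (a b : nat) : (\sum_(a <= j < b) tailsum (nseq w 0%N) j = 0)%N.
  by rewrite big1.
rewrite /weight !sum0 big1 => [|j _]; last by rewrite tailsum0.
rewrite -nth_last nth_nseq if_same !expr0n /= qbin_q0 !mul1r.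
rewrite big1 // => j _; rewrite sum0 nth_nseq if_same qbin_q0.
by rewrite (_ : (_ <= _ <= _) = true) //; lia.
Qed.

Lemma fsum_lhs_term_q0 :
  \sum_(x \in [set: nat * nat * v.-1.-tuple nat]) lhs_term (0 : F) Delta L x
  = (Delta <= L)%:R.
Proof.
pose x0 : nat * nat * v.-1.-tuple nat := (0%N, 0%N, [tuple of nseq v.-1 0%N]).
rewrite (fsum_supp1 (i0 := x0)) => [|[[m k] n] nz].
  rewrite lhs_termE // weight_q0 expr0n /qtrin !qbin_q0 mul1r mulr1.
  rewrite -natrM mulnb.
  by congr (_ : bool)%:R; lia.
have [_ _ le_nk] := lhs_term_supp v_ge2 lt_Dv nz.
move: nz; rewrite lhs_termE // !mulf_eq0 !negb_or expf_eq0 eqxx andbT -eqn0Ngt.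
move=> /andP[/andP[/eqP exp0 _] _]; have [m0 k0] : m = 0%N /\ k = 0%N by nia.
rewrite m0 k0 in le_nk *; congr (_, _, _); apply: val_inj => /=.
by move: le_nk; rewrite leqn0 => /natnseq0P; rewrite size_tuple.
Qed.

Lemma fsum_rhs_term_q0 :
  \sum_(j \in [set: int]) rhs_term (0 : F) v Delta L j = (Delta <= L)%:R.
Proof.
rewrite (fsum_supp1 (i0 := 0)) => [|j].
  rewrite /rhs_term expr0n !mulr0 addr0 !expr0z !mul1r subr0 qbin_q0.
  by congr (_ : bool)%:R; lia.
rewrite /rhs_term !mulf_eq0 !negb_or (expfz_eq0 (0 : F)) eqxx andbT negbK.
by move=> /andP[/andP[_ /eqP exp0] _]; nia.
Qed.

End QZero.

Theorem theorem1p1 (F : fieldType) (q : F) (v Delta L : nat) :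
  (forall i : nat, (0 < i)%N -> q ^+ i != 1) ->
  (2 <= v)%N -> (Delta < v)%N ->
  \sum_(x \in [set: nat * nat * v.-1.-tuple nat]) lhs_term q Delta L x =
  \sum_(j \in [set: int]) rhs_term q v Delta L j.
Proof.
move=> q_generic v_ge2 lt_Dv; have [->|q_neq0] := eqVneq q 0.
  by rewrite fsum_lhs_term_q0 // fsum_rhs_term_q0.
rewrite fsum_lhs_term // -(@sumZ_fsum _ L.+1) => [|j /(rhs_term_supp lt_Dv)];
  last by lia.
case: v v_ge2 lt_Dv => [|[|w]] // _ lt_Dv.
pose c (j : int) := (-1) ^ j * q ^ ((w%:Z + 2) * j ^+ 2 + Delta%:Z * j).
pose a (m k : nat) := q ^+ ((m + k) ^ 2 + k ^ 2 + Delta * (m + 2 * k))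
  * qtrin q L m (2 * k + Delta)%N.
transitivity (\sum_(m < L.+1) \sum_(k < L.+1) sumZ L.+1 (fun j =>
    c j * (a m k * qbin q (2 * k%:Z + Delta%:Z) (k%:Z - (w%:Z + 2) * j)))).
  apply: eq_bigr => m _; apply: eq_bigr => k _.
  rewrite sum_weight_bose // mulr_sumZ; apply: eq_sumZ => j.
  by rewrite /a /c; ring.
under eq_bigr do rewrite exchange_sumZ.
rewrite exchange_sumZ; apply: eq_sumZ => j.
under eq_bigr do rewrite -mulr_sumr.
rewrite -mulr_sumr sum_qtrin //; last first.
  by have [|] := lerP 0 j; nia.
rewrite [LHS]mulrA -[c j * _]mulrA -expfzDr // /rhs_term.
congr (_ * q ^ _ * qbin q _ _); rewrite -[w.+2]addn2 PoszD; ring.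
Qed.
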